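(* Let $P$ be a $\gamma$-homogeneous operator ($\gamma\in\mathbb{R}$) on a set $\mathcal{X}$ in a Hilbert space, and let the solution $u$ of the nonlinear flow $$u_t(t)=P(u(t)),\qquad u(0)=f\in\mathcal{X},$$ exist. Then the solution is shape preserving, i.e. $u(t)=a(t)\cdot f$, if and only if the initial condition $f$ is an eigenfunction of $P$ with eigenvalue $\lambda$, i.e. $P(f)=\lambda\cdot f$ with $\lambda\in\mathbb{R}$. In that case, the decay profile is $$a(t)=\left[\left((1-\gamma)\lambda t+1\right)^+\right]^{\frac{1}{1-\gamma}}.$$
   Context: Notation: $q^+=\max\{0,q\}$, and $\langle\cdot,\cdot\rangle$ is the inner product of the Hilbert space. $P$ is $\gamma$-homogeneous ($\gamma$ not necessarily an integer) if $P(cu)=c|c|^{\gamma-1}P(u)$ for all $c\in\mathbb{R}$. In the nonlinear flow, $-P$ is by definition a maximally monotone operator, $P(0)=0$, and the solution is assumed to be unique and differentiable with respect to $t\in(0,\tau)$, $\tau\in\mathbb{R}_{>0}$. An operator $Q$ on $\mathcal{X}$ is monotone if $\langle Q(u)-Q(v),u-v\rangle\ge 0$ for all $u,v\in\mathcal{X}$. It is maximally monotone if there is no other monotone operator whose domain properly contains $\mathcal{X}$. A solution is called shape preserving if it has separated variables, $u(t)=a(t)\cdot f$, with $a$ a scalar function of time. The function $a(t)$ is called its decay profile. An element $v\in\mathcal{X}$ is a (nonlinear) eigenfunction of $P$ if there exists $\lambda\in\mathbb{R}$ such that $P(v)=\lambda\cdot v$. For $\gamma=1$ the expression for $a(t)$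 is read as its limit $e^{\lambda t}$ as $\gamma\to1$. *)

(* Defs.v *)
From mathcomp Require Export all_boot all_order all_algebra.
From mathcomp Require Export sesquilinear.
From mathcomp Require Export all_classical all_reals all_analysis.

Set Implicit Arguments.
Unset Strict Implicit.
Unset Printing Implicit Defensive.

Export Order.TTheory GRing.Theory Num.Theory.
Export numFieldNormedType.Exports.
Local Open Scope classical_set_scope.
Local Open Scope ring_scope.

(* A real Hilbert space is a complete normed module [V] together with a
   positive definite symmetric bilinear form that induces its norm. *)
Definition induces_norm (R : realType) (V : completeNormedModType R)
    (ip : {dot V for (@idfun R)}) : Prop :=
  forall x : V, ip x x = `|x| ^+ 2.

(* An operator on a set [X] of [V] is a function on [V] of which only the
   values on [X] are ever constrained or used. *)
Section Operators.
Context (R : realType) (V : completeNormedModType R).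
Implicit Types (X Y : set V) (P Q : V -> V).

(* [X (c *: u)] says that [P (c *: u)] is defined. At [c = 0] the factor
   [c * `|c| `^ (gamma - 1)] is [0] for every [gamma]. *)
Definition homogeneous (gamma : R) X P : Prop :=
  forall (c : R) (u : V), X u ->
    X (c *: u) /\ P (c *: u) = (c * `|c| `^ (gamma - 1)) *: P u.

Definition monotone_op (ip : {dot V for (@idfun R)}) X Q : Prop :=
  forall u v : V, X u -> X v -> 0 <= ip (Q u - Q v) (u - v).

(* Maximality is with respect to extension of (single-valued) operators. *)
Definition maximally_monotone (ip : {dot V for (@idfun R)}) X Q : Prop :=
  monotone_op ip X Q /\
  ~ (exists Y Q', [/\ X `<` Y, (forall u, X u -> Q' u = Q u)
                    & monotone_op ip Y Q']).

Definition eigenfunction X P (v : V) : Prop :=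
  X v /\ exists lambda : R, P v = lambda *: v.

(* The right limit at [0] ties the initial value to the flow: the equation
   itself is only imposed on the open interval. *)
Definition flow_solution X P (tau : R) (f : V) (u : R -> V) : Prop :=
  [/\ forall t : R, 0 <= t < tau -> X (u t),
      u 0 = f,
      u t @[t --> 0^'+] --> u 0
    & forall t : R, 0 < t < tau -> derivable u t 1 /\ u^`()%classic t = P (u t)].

Definition has_decay_profile (tau : R) (f : V) (u : R -> V) (a : R -> R)
  : Prop := forall t : R, 0 <= t < tau -> u t = a t *: f.

Definition shape_preserving (tau : R) (f : V) (u : R -> V) : Prop :=
  exists a : R -> R, has_decay_profile tau f u a.

End Operators.

(* For [gamma = 1] this is the limit of the general formula as
   [gamma] tends to [1]. *)
Definition decay (R : realType) (gamma lambda t : R) : R :=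
  if gamma == 1 then expR (lambda * t)
  else Num.max 0 ((1 - gamma) * lambda * t + 1) `^ (1 - gamma)^-1.

(* Main.v *)
(* Since [- P] is monotone, the distance between two solutions of the flow is
   nonincreasing, so a solution is determined on any initial subinterval by its
   right limit at the left end.  If [P f = lambda *: f], the function
   [decay gamma lambda t *: f] solves the flow as long as the base
   [(1 - gamma) * lambda * t + 1] is positive, hence equals [u] there.  It need
   not be differentiable where the base vanishes (when [gamma <= 0]), but
   comparing [u] with the zero solution from times at which the base is
   arbitrarily small gives [u t = 0] from then on.
   Conversely, if [u t = a t *: f], then [u' t] lies on the line spanned by [f],
   and it is a nonzero multiple of [P f] at any [t] with [a t != 0]. *)
Require Import Defs.
From mathcomp Require Import ring lra.
Local Open Scope classical_set_scope.
Local Open Scope ring_scope.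

(** * Derivatives of curves as limits of difference quotients *)

Section Derivatives.
Context {R : realType} {V : normedModType R}.

Lemma is_derive_cvgP {u : R -> V} {t : R} {du : V} :
  is_derive t 1 u du <->
  h^-1 *: (u (h + t) - u t) @[h --> 0^'] --> du.
Proof.
have -> : (fun h : R => h^-1 *: (u (h + t) - u t)) =
          (fun h : R => h^-1 *: ((u \o shift t) (h *: 1) - u t)).
  by apply/funext => h; rewrite /= [h *: 1]mulr1.
split => [[ud <-]|uc]; first exact: ud.
by split; [exact: cvgP uc|exact: cvg_lim uc].
Qed.

Lemma is_derive_continuous {u : R -> V} {t : R} {du : V} :
  is_derive t 1 u du -> u s @[s --> t] --> u t.
Proof. by case=> /derivable1_diffP /differentiable_continuous. Qed.

End Derivatives.

Lemma is_derive_scalel {R : realType} {V : normedModType R}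
    {k : R -> R} (f : V) {t dk : R} :
  is_derive t 1 k dk -> is_derive t 1 (fun s => k s *: f) (dk *: f).
Proof.
move=> /is_derive_cvgP kc; apply/is_derive_cvgP.
under eq_fun do rewrite -scalerBl scalerA.
exact: cvgZr_tmp kc.
Qed.

(** * Continuity and differentiation of the inner product *)

Section Dot.
Context {R : realType} {V : completeNormedModType R}.
Context {ip : {dot V for (@idfun R)}} (Hip : induces_norm ip).

Lemma dotC (x y : V) : ip x y = ip y x.
Proof. by rewrite (hermC ip) expr0 mul1r. Qed.

(** Polarization reduces the continuity of [ip] to that of the norm. *)
Lemma dot_polar (x y : V) :
  ip x y = 4^-1 * (`|x + y| ^+ 2 - `|x - y| ^+ 2).
Proof.
by rewrite -!Hip hnormD hnormB /= expr0 mul1r; lra.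
Qed.

Lemma cvg_dot {T : Type} {F : set_system T} {FF : Filter F}
    {g h : T -> V} {x y : V} :
  g s @[s --> F] --> x -> h s @[s --> F] --> y ->
  ip (g s) (h s) @[s --> F] --> ip x y.
Proof.
move=> gx hy; rewrite dot_polar; under eq_fun do rewrite dot_polar.
apply: cvgM; first exact: cvg_cst.
apply: cvgB; rewrite expr2; apply: cvgM; apply: cvg_norm;
  by [apply: cvgD|apply: cvgB].
Qed.

Lemma is_derive_sqr_norm {w : R -> V} {t : R} {dw : V} :
  is_derive t 1 w dw ->
  is_derive t 1 (fun s => `|w s| ^+ 2) (2 * ip dw (w t)).
Proof.
move=> wd; have wc := is_derive_continuous wd.
apply/is_derive_cvgP.
(* Factoring the difference of squares turns the quotient into the inner product of the difference
   quotient of [w] with a sum tending to [w t + w t]. *)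
have dotBD (x y : V) : ip (x - y) (x + y) = `|x| ^+ 2 - `|y| ^+ 2.
  by rewrite linearBl /= !linearDr /= !Hip (dotC y x); ring.
have -> : (fun h => h^-1 *: (`|w (h + t)| ^+ 2 - `|w t| ^+ 2)) =
    (fun h => ip (h^-1 *: (w (h + t) - w t)) (w (h + t) + w t)).
  by apply/funext => h; rewrite linearZl_LR /= dotBD.
rewrite (_ : 2 * _ = ip dw (w t + w t)); last by rewrite linearDr /=; ring.
apply: cvg_dot; first exact/is_derive_cvgP.
apply: cvgD; last exact: cvg_cst.
have st : h + t @[h --> 0^'] --> t.
  suff : h + t @[h --> 0^'] --> 0 + t by rewrite add0r.
  by apply: cvgD; [exact: nbhs_dnbhs|exact: cvg_cst].
exact: (cvg_comp (fun h => h + t) w st wc).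
Qed.

Lemma is_derive_dotl {w : R -> V} {t : R} {dw : V} (f : V) :
  is_derive t 1 w dw -> is_derive t 1 (fun s => ip (w s) f) (ip dw f).
Proof.
move=> /is_derive_cvgP wc; apply/is_derive_cvgP.
under eq_fun do rewrite -linearBl /= -[_ *: _]linearZl_LR.
by apply: cvg_dot; [exact: wc|exact: cvg_cst].
Qed.

End Dot.

(** The interval is open at [a], as the flow equation is not imposed at the initial time, and closed
    at [b], where solutions get compared. *)
Definition solves_on {R : realType} {V : normedModType R}
    (X : set V) (P : V -> V) (a b : R) (u : R -> V) : Prop :=
  forall t, a < t <= b -> X (u t) /\ is_derive t 1 u (P (u t)).

(** * Contraction and uniqueness for monotone flows *)

Section Flow.
Context {R : realType} {V : completeNormedModType R}.
Context {ip : {dot V for (@idfun R)}} (Hip : induces_norm ip).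
Context {X : set V} {P : V -> V}.
Hypothesis P_mono : monotone_op ip X (fun v => - P v).

(** The squared distance is differentiable even where the solutions meet, and its derivative
    [2 * ip (P u - P v) (u - v)] is nonpositive by monotonicity of [- P]. *)
Lemma flow_contraction {a b x y : R} {u v : R -> V} :
  solves_on X P a b u -> solves_on X P a b v ->
  a < x -> x <= y -> y <= b -> `|u y - v y| <= `|u x - v x|.
Proof.
move=> us vs ax xy yb.
have d t : x <= t <= y -> is_derive t 1 (fun s => `|u s - v s| ^+ 2)
    (2 * ip (P (u t) - P (v t)) (u t - v t)) /\
    2 * ip (P (u t) - P (v t)) (u t - v t) <= 0.
  move=> /andP[xt ty].
  have tab : a < t <= b by rewrite (lt_le_trans ax xt) (le_trans ty yb).
  have [Xu du] := us t tab; have [Xv dv] := vs t tab.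
  split; first exact: (is_derive_sqr_norm Hip (is_deriveB du dv)).
  have := P_mono (u t) (v t) Xu Xv.
  rewrite -opprD linearNl oppr_ge0 => ?.
  by rewrite pmulr_rle0.
rewrite -ler_sqr ?nnegrE//.
apply: (@ler0_derive1_nincr _ (fun s => `|u s - v s| ^+ 2) x y) => //.
- by move=> t /subset_itv_oo_cc; rewrite in_itv /= => /d[[]].
- move=> t /subset_itv_oo_cc; rewrite in_itv /= => /d[[_]].
  by rewrite derive1E => -> .
- apply: derivable_within_continuous => t.
  by rewrite in_itv /= => /d[[]].
Qed.

Lemma flow_unique {a b : R} {u v : R -> V} {z : V} :
  a < b -> solves_on X P a b u -> solves_on X P a b v ->
  u t @[t --> a^'+] --> z -> v t @[t --> a^'+] --> z -> u b = v b.
Proof.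
move=> ab us vs uz vz.
apply/eqP; rewrite -subr_eq0 -normr_le0 -[leRHS](@normr0 _ V) -(subrr z).
apply: (@cvgr_to_ge _ (a^'+) _ _ (fun t => `|u t - v t|)).
  by apply: cvg_norm; apply: cvgB.
near=> t; apply: (flow_contraction us vs); last by [].
  by near: t; exact: nbhs_right_gt.
by near: t; exact: nbhs_right_le.
Unshelve. all: by end_near. Qed.

(** Monotonicity is tested on the pair [f], [0]. *)
Lemma eigenvalue_le0 {f : V} {lambda : R} :
  X 0 -> P 0 = 0 -> X f -> f != 0 -> P f = lambda *: f -> lambda <= 0.
Proof.
move=> X0 P0 Xf f0 Pf; have := P_mono f 0 Xf X0.
rewrite P0 Pf oppr0 oppr0 !addr0 -scaleNr linearZl_LR /= Hip.
by rewrite pmulr_lge0 ?exprn_gt0 ?normr_gt0// oppr_ge0.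
Qed.

End Flow.

(** * The scalar decay profile *)

Section Decay.
Context {R : realType}.

Lemma decay0 (gamma lambda : R) : decay gamma lambda 0 = 1.
Proof.
rewrite /decay; case: ifP => _; rewrite mulr0 ?expR0//.
by rewrite add0r max_r ?ler01// powR1.
Qed.

Lemma decay_eq0 {gamma lambda t : R} :
  (1 - gamma) * lambda * t + 1 <= 0 -> decay gamma lambda t = 0.
Proof.
(* At [gamma = 1] the base is [1], against the hypothesis; otherwise the exponent is nonzero, which
   matters because [powR 0 0 = 1]. *)
rewrite /decay; have [->|g1] := eqVneq.
  by rewrite subrr !mul0r add0r ler10.
by move=> b0; rewrite max_l// powR0// invr_eq0 subr_eq0 eq_sym.
Qed.

Lemma decay_gt0 {gamma lambda t : R} :
  0 < (1 - gamma) * lambda * t + 1 -> 0 < decay gamma lambda t.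
Proof.
rewrite /decay; case: ifP => _ b0; first exact: expR_gt0.
by rewrite powR_gt0// lt_max b0 orbT.
Qed.

(** This is the scalar equation to which the flow reduces on the ray through an eigenfunction. Where
    the base is positive, the maximum with [0] is locally inactive. *)
Lemma is_derive_decay {gamma lambda t : R} :
  0 < (1 - gamma) * lambda * t + 1 ->
  is_derive t 1 (decay gamma lambda) (lambda * decay gamma lambda t `^ gamma).
Proof.
have dlin (k c : R) : is_derive t 1 (fun s => k * s + c) k.
  have H := @is_deriveD _ _ _ _ _ _ _ _ _ (is_deriveZ k (is_derive_id t 1))
                                       (is_derive_cst c t 1).
  by apply: is_derive_eq H _; rewrite addr0 [_ *: _]mulr1.
move=> b0; have := decay_gt0 b0; rewrite /decay; have [->|g1] := eqVneq.
  move=> e0; rewrite powRr1 ?ltW// mulrC.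
  apply: is_derive1_comp.
  by have := dlin lambda 0; under eq_fun do rewrite addr0.
move=> _; set k := (1 - gamma) * lambda in b0 *; set p := (1 - gamma)^-1.
have g1' : 1 - gamma != 0 by rewrite subr_eq0 eq_sym.
apply: (@near_eq_is_derive _ _ _ ((fun x => x `^ p) \o (fun s => k * s + 1))).
  have bpos := is_derive_continuous (dlin k 1) _ (lt_nbhsr b0).
  near=> s; rewrite /= max_r// ltW//.
  by near: s; exact: bpos.
rewrite max_r ?ltW//.
have -> : lambda * ((k * t + 1) `^ p) `^ gamma = p * (k * t + 1) `^ (p - 1) * k.
  rewrite -powRrM.
  have -> : p * gamma = p - 1 by rewrite /p; field.
  by rewrite /k /p; field.
by apply: is_derive1_comp; exact: is_derive1_powR.
Unshelve. all: by end_near. Qed.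

End Decay.

(** * Solutions starting from eigenfunctions, and shape-preserving solutions *)

Section EigenvectorFlow.
Context {R : realType} {V : completeNormedModType R}.
Context {ip : {dot V for (@idfun R)}} (Hip : induces_norm ip).
Context {X : set V} {P : V -> V} {gamma : R}.
Hypothesis P_homog : homogeneous gamma X P.
Hypothesis P_mono : monotone_op ip X (fun v => - P v).
Context {f : V} (Xf : X f).

Lemma decay_solves_on {lambda a b : R} : P f = lambda *: f ->
  (forall s, a < s <= b -> 0 < (1 - gamma) * lambda * s + 1) ->
  solves_on X P a b (fun s => decay gamma lambda s *: f).
Proof.
move=> Pf pos s /pos bs; have d0 := decay_gt0 bs.
have [Xd ->] := P_homog (decay gamma lambda s) f Xf.
split=> //; apply: is_derive_eq (is_derive_scalel f (is_derive_decay bs)) _.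
rewrite Pf scalerA gtr0_norm// [RHS]/(_ *: _) mulrC; congr (_ * _ *: _).
rewrite -{2}(powRr1 (ltW d0)) -powRD; last by rewrite (gt_eqF d0) implybT.
by rewrite addrC subrK.
Qed.

Lemma shape_preserving_eigenfunction {tau : R} {u : R -> V} :
  0 < tau -> f != 0 -> flow_solution X P tau f u ->
  shape_preserving tau f u -> eigenfunction X P f.
Proof.
move=> tau0 f0 [uX u0 u_cts u_der] [a ua]; split=> //.
have n0 : 0 < `|f| ^+ 2 by rewrite exprn_gt0 ?normr_gt0.
(* No regularity of [a] is assumed, so a time with [a t != 0] is found through the right continuity
   of [u] at [0]. *)
have g_cts : ip (u t) f @[t --> 0^'+] --> `|f| ^+ 2.
  by rewrite -Hip -[X in ip X _]u0; apply: (cvg_dot Hip) => //; exact: cvg_cst.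
have [t [t0 tt g0]] : exists t, [/\ 0 < t, t < tau & 0 < ip (u t) f].
  near (0 : R)^'+ => t; exists t; split; near: t.
  - exact: nbhs_right_gt.
  - exact: nbhs_right_lt.
  - exact: (cvgr_gt _ g_cts _ n0).
have tt0 : 0 <= t < tau by rewrite ltW.
have at0 : a t != 0.
  by apply: contraTneq g0 => at0; rewrite ua// at0 scale0r linear0l ltxx.
have [ud u'] := u_der t ltac:(by rewrite t0 tt).
have du : is_derive t 1 u (P (u t)) by split=> //; rewrite -derive1E.
(* Near [t] the curve [u] equals its own orthogonal projection onto the line of [f], so its
   derivative lies on that line without differentiating [a]. *)
have dproj : is_derive t 1 u (ip (P (u t)) f *: ((`|f| ^+ 2)^-1 *: f)).
  apply: near_eq_is_derive (is_derive_scalel _ (is_derive_dotl Hip f du)).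
  near=> s; rewrite ua; last first.
    apply/andP; split; near: s; [exact: lt_le_nbhsr|exact: lt_nbhsl].
  rewrite linearZl_LR /= Hip scalerA -mulrA mulfV ?mulr1//.
  by rewrite gt_eqF.
have PE : P (u t) = ip (P (u t)) f *: ((`|f| ^+ 2)^-1 *: f).
  by rewrite -[LHS](@derive_val _ _ _ _ _ _ _ du) derive_val.
have [_ Pu] := P_homog (a t) f Xf.
set c := a t * _ in Pu.
have c0 : c != 0 by rewrite mulf_neq0// powR_eq0 normr_eq0 (negPf at0).
exists (c^-1 * (ip (P (u t)) f / `|f| ^+ 2)).
by rewrite -!scalerA -PE ua// Pu scalerA mulVf// scale1r.
Unshelve. all: by end_near. Qed.

Lemma eigenfunction_decay {tau lambda : R} {u : R -> V} :
  X 0 -> P 0 = 0 -> f != 0 -> flow_solution X P tau f u ->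
  P f = lambda *: f -> has_decay_profile tau f u (decay gamma lambda).
Proof.
move=> X0 P0 f0 [uX u0 u_cts u_der] Pf t /andP[t0 tt].
have l0 : lambda <= 0 := eigenvalue_le0 Hip P_mono X0 P0 Xf f0 Pf.
have us : solves_on X P 0 t u.
  move=> s /andP[s0 st]; have st' := le_lt_trans st tt.
  split; first by apply: uX; rewrite ltW.
  have [ud u'] := u_der s ltac:(by rewrite s0 st').
  by split=> //; rewrite -derive1E.
have decay_at0 : decay gamma lambda s *: f @[s --> 0^'+] --> f.
  rewrite -[X in _ --> X]scale1r -(decay0 gamma lambda).
  apply: cvgZr_tmp; apply: cvg_at_right_filter.
  by apply: is_derive_continuous; apply: is_derive_decay; rewrite mulr0 add0r.
have [t_eq0|t_neq0] := eqVneq t 0.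
  by rewrite t_eq0 u0 decay0 scale1r.
have t_gt0 : 0 < t by rewrite lt_neqAle eq_sym t_neq0.
set k := (1 - gamma) * lambda.
have [bt|bt] := ltP 0 (k * t + 1).
  apply: (flow_unique Hip P_mono t_gt0 us _ _ decay_at0); last by rewrite -u0.
  apply: decay_solves_on => // s /andP[s0 st].
  (* The base is affine in time and equals [1] at [0], so positivity at [t] gives positivity at all
     earlier times. *)
  by rewrite -/k; have [k0|k0] := leP 0 k; nra.
rewrite decay_eq0// scale0r.
have k0 : k < 0 by nra.
have zs : solves_on X P 0 t (fun=> 0).
  by move=> s _; rewrite P0; split => //; exact: is_derive_cst.
(* With [lambda <= 0], the sign of [k] forces [gamma < 1]; a positive exponent makes the bound below
   tend to [0] with [y]. *)
have p0 : 0 < (1 - gamma)^-1 by rewrite invr_gt0; rewrite /k in k0; nra.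
(* [x] below is the time at which the base [k * x + 1] equals [y]. *)
have bound y : 0 < y < 1 -> `|u t| <= y `^ (1 - gamma)^-1 * `|f|.
  move=> /andP[y0 y1]; pose x := (y - 1) / k.
  have kx : k * x = y - 1 by rewrite /x; field; rewrite lt_eqF.
  have x0 : 0 < x by nra.
  have xt : x <= t by nra.
  have ux : u x = decay gamma lambda x *: f.
    have us' : solves_on X P 0 x u.
      by move=> s /andP[s0 sx]; apply: us; rewrite s0 (le_trans sx).
    apply: (flow_unique Hip P_mono x0 us' _ _ decay_at0); last by rewrite -u0.
    apply: decay_solves_on => // s /andP[s0 st].
    by rewrite -/k; nra.
  have := flow_contraction Hip P_mono us zs x0 xt (lexx t).
  rewrite !subr0 ux normrZ ger0_norm; last first.
    by rewrite ltW// decay_gt0// -/k kx subrK.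
  rewrite /decay -/k kx subrK (max_r (ltW y0)) ifN//.
  by apply: contraTneq k0 => g1; rewrite /k g1 subrr mul0r ltxx.
apply/eqP; rewrite -normr_le0 -(mul0r `|f|).
apply: (@cvgr_to_ge _ ((0 : R)^'+) _ _ (fun y => y `^ (1 - gamma)^-1 * `|f|)).
  by apply: cvgMr_tmp; exact: powR_cvg0.
near=> y; apply: bound; apply/andP; split; near: y.
- exact: nbhs_right_gt.
- exact: nbhs_right_lt.
Unshelve. all: by end_near. Qed.

End EigenvectorFlow.

Theorem theorem1 (R : realType) (V : completeNormedModType R)
    (ip : {dot V for (@idfun R)}) (Hip : induces_norm ip)
    (X : set V) (P : V -> V) (gamma : R)
    (P_homog : homogeneous gamma X P)
    (P_maxmono : maximally_monotone ip X (fun v => - P v))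
    (P0 : X 0 /\ P 0 = 0)
    (tau : R) (tau_gt0 : 0 < tau)
    (f : V) (Xf : X f)
    (u : R -> V) (u_sol : flow_solution X P tau f u)
    (u_unique : forall v : R -> V, flow_solution X P tau f v ->
       forall t : R, 0 <= t < tau -> v t = u t) :
  (shape_preserving tau f u <-> eigenfunction X P f) /\
  (forall lambda : R, P f = lambda *: f ->
     has_decay_profile tau f u (decay gamma lambda) /\
     (f != 0 -> forall a : R -> R, has_decay_profile tau f u a ->
        forall t : R, 0 <= t < tau -> a t = decay gamma lambda t)).
Proof.
have [P_mono _] := P_maxmono; have [X0 P00] := P0.
have profile lambda : P f = lambda *: f ->
    has_decay_profile tau f u (decay gamma lambda).
  (* For [f = 0] every [lambda] satisfies [Pf], so its sign is undetermined; here the assumed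
     uniqueness identifies [u] with the zero solution. *)
  move=> Pf; have [f0|f0] := eqVneq f 0; last first.
    exact: (eigenfunction_decay Hip P_homog P_mono Xf X0 P00 f0 u_sol Pf).
  move=> t tt; rewrite f0 scaler0 -(u_unique (fun=> 0))//.
  split=> [//|//||s _]; first exact: cvg_cst.
  by rewrite derive1_cst P00; split.
split; [split|].
- have [f0 _|f0] := eqVneq f 0.
    by split=> //; exists 0; rewrite f0 P00 scaler0.
  exact: (shape_preserving_eigenfunction Hip P_homog Xf tau_gt0 f0 u_sol).
- by move=> [_ [lambda /profile ua]]; exists (decay gamma lambda).
- move=> lambda /profile ua; split=> // f0 a ua' t tt.
  apply/eqP; rewrite -subr_eq0; have := ua t tt; rewrite ua'// => /eqP.
  by rewrite -subr_eq0 -scalerBl scaler_eq0 (negPf f0) orbF.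
Qed.
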